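(* Let $q$ be a prime power and let $k\ge 0$ be an integer with $k\le q$. Let $W$ be a $\mathrm{GL}_2(\mathbb F_q)$-invariant subspace of $\mathbb F_q[X,Y]_k$. If $\mathcal B_W\neq\varnothing$ (equivalently, if $d(C_W)=q+1-k$), then the supports of the minimum-weight codewords in $C_W$ form a $3$-$(q+1,q+1-k,\lambda)$ design on $\mathbb P^1(\mathbb F_q)$ for some $\lambda$.
   Context: $\mathbb F_q[X,Y]_k$ is the $\mathbb F_q$-space of homogeneous polynomials of degree $k$ in $X,Y$ over $\mathbb F_q$ (including $0$). The group $\mathrm{GL}_2(\mathbb F_q)$ acts on it by $(g\cdot f)(X,Y)=f(dX-bY,-cX+aY)$ for $g=\begin{pmatrix}a&b\\c&d\end{pmatrix}$; an $\mathbb F_q$-subspace $W$ is $\mathrm{GL}_2(\mathbb F_q)$-invariant if $g\cdot f\in W$ for all $g\in\mathrm{GL}_2(\mathbb F_q)$, $f\in W$. $\mathbb P^1(\mathbb F_q)=\mathbb F_q\cup\{\infty\}$, where $x\in\mathbb F_q$ corresponds to $[x:1]$ and $\infty$ to $[1:0]$. For a $k$-subset $S\subseteq\mathbb P^1(\mathbb F_q)$, $F_S(X,Y)=\prod_{t\in S}(X-tY)$, where the factor for $t=\infty$ is taken to be $Y$. The block set is $\mathcal B_W=\{S\subseteq\mathbb P^1(\mathbb F_q): |S|=k,\ F_S\in W\}$. The evaluation map is $\mathrm{Ev}:\mathbb F_q[X,Y]_k\to\mathbb F_q^{q+1}$, $f\mapsto((f(a,1))_{a\in\mathbb F_q},f(1,0))$,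 with coordinates indexed by $\mathbb P^1(\mathbb F_q)$ (the last one by $\infty$), and $C_W=\mathrm{Ev}(W)$. For a codeword $c=(c_x)_{x\in\mathbb P^1(\mathbb F_q)}$, its support is $\{x:c_x\ne0\}$ and its weight is the size of the support. $d(C)$ is the minimum weight of a nonzero codeword of $C$; minimum-weight codewords are the codewords of weight $d(C)$. A $t$-$(v,k,\lambda)$ design is a pair $(P,\mathcal B)$ with $P$ a finite set, $|P|=v$, and $\mathcal B$ a set (without repetitions) of $k$-subsets of $P$ such that every $t$-subset of $P$ is contained in exactly $\lambda$ members of $\mathcal B$. *)

(* Defs.v *)
From HB Require Import structures.
From mathcomp Require Import all_boot all_order all_algebra.
From mathcomp.multinomials Require Import mpoly.

Set Implicit Arguments.
Unset Strict Implicit.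
Unset Printing Implicit Defensive.

Import GRing.Theory.
Local Open Scope ring_scope.

Section Design.
Variable P : finType.

Definition is_design (t v k lambda : nat) (B : {set {set P}}) : Prop :=
  [/\ #|P| = v,
      forall S : {set P}, S \in B -> #|S| = k &
      forall T : {set P}, #|T| = t ->
        #|[set S in B | T \subset S]| = lambda].

End Design.

Section Code.
Variables (F : finFieldType) (P : finType).
Implicit Types (c : {ffun P -> F^o}) (C : {vspace {ffun P -> F^o}}).

Definition supp c : {set P} := [set x | c x != 0].

Definition wt c : nat := #|supp c|.

(* [vpick C] is a nonzero element of C unless C is the zero code; for the zero
   code, which has no minimum distance, this definition gives the value 0. *)
Definition min_dist C : nat :=
  wt [arg min_(c < vpick C | (c \in C) && (c != 0)) wt c].

Definition min_supports C : {set {set P}} :=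
  [set supp c | c in [pred c | (c \in C) && (wt c == min_dist C)]].

End Code.

Section BinaryForms.
Variable F : finFieldType.

Definition X : {mpoly F[2]} := 'X_0.
Definition Y : {mpoly F[2]} := 'X_1.

Definition lin_subst (g : 'M[F]_2) : 2.-tuple {mpoly F[2]} :=
  [tuple g 1 1 *: X - g 0 1 *: Y; - g 1 0 *: X + g 0 0 *: Y].

Lemma X_homog : X \is 1.-homog.
Proof. by rewrite dhomogX /= mdeg1. Qed.

Lemma Y_homog : Y \is 1.-homog.
Proof. by rewrite dhomogX /= mdeg1. Qed.

Lemma lin_subst_homog g i : tnth (lin_subst g) i \is 1.-homog.
Proof.
have Xh := X_homog; have Yh := Y_homog.
case: i => [[|[|//]] lti]; rewrite (tnth_nth 0) /=.
- by rewrite rpredB ?rpredZ.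
- by rewrite rpredD ?rpredZ.
Qed.

Lemma act_homog k (g : 'M[F]_2) (f : dhomog 2 F k) :
  (f : {mpoly F[2]}) \mPo lin_subst g \is k.-homog.
Proof.
rewrite comp_mpolyEX big_seq rpred_sum // => m /(dhomog_mf (dhomog_is_dhomog f)) mk.
rewrite rpredZ // comp_mpolyX -mk /= mdegE.
elim/big_rec2: _ => [|i p d _ dp]; first exact: dhomog1.
apply: dhomogM dp; rewrite -[X in X.-homog]mul1n.
exact: dhomogMn (lin_subst_homog g i).
Qed.

(* For g = [a, b; c, d] this is f(dX - bY, -cX + aY). *)
Definition act k (g : 'M[F]_2) (f : dhomog 2 F k) : dhomog 2 F k :=
  DHomog (act_homog g f).

Definition GL2_invariant k (W : {vspace dhomog 2 F k}) : Prop :=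
  forall g : 'M[F]_2, g \in unitmx ->
  forall f : dhomog 2 F k, f \in W -> act g f \in W.

(* The projective line: [Some x] is [x : 1], and [None] is the point at
   infinity [1 : 0]. *)
Definition P1 : finType := option F.

Definition P1_coord (x : P1) : 2.-tuple F :=
  if x is Some a then [tuple a; 1] else [tuple 1; 0].

Definition lin_factor (x : P1) : {mpoly F[2]} :=
  if x is Some t then X - t *: Y else Y.

Definition F_ (S : {set P1}) : {mpoly F[2]} := \prod_(t in S) lin_factor t.

Lemma F_homog S : F_ S \is #|S|.-homog.
Proof.
rewrite /F_ -sum1_card; elim/big_rec2: _ => [|x p d _ dp]; first exact: dhomog1.
apply: dhomogM dp; have Xh := X_homog; have Yh := Y_homog.
by case: x => [t|] //=; rewrite rpredB ?rpredZ.
Qed.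

(* [indhomog] is the partial inverse of the inclusion of the forms of degree k
   into the polynomials; it is only used on F_S of degree |S| = k (F_homog). *)
Definition blocks k (W : {vspace dhomog 2 F k}) : {set {set P1}} :=
  [set S : {set P1} | (#|S| == k) && (indhomog k (F_ S) \in W)].

Definition Ev k (f : dhomog 2 F k) : {ffun P1 -> F^o} :=
  [ffun x => (f : {mpoly F[2]}).@[tnth (P1_coord x)]].

Lemma Ev_is_linear k : linear (@Ev k).
Proof. by move=> a f g; apply/ffunP=> x; rewrite !ffunE /= mevalD mevalZ. Qed.

HB.instance Definition _ k :=
  GRing.isLinear.Build F (dhomog 2 F k) {ffun P1 -> F^o} _ (@Ev k)
    (@Ev_is_linear k).

Definition code k (W : {vspace dhomog 2 F k}) : {vspace {ffun P1 -> F^o}} :=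
  (linfun (@Ev k) @: W)%VS.

End BinaryForms.

(* Main.v *)
(* A nonzero form of degree k has at most k zeros on the projective line, and a
   form vanishing exactly on a k-set S is proportional to F_S; hence the minimum
   weight is q + 1 - k exactly when some F_S lies in W.  The action of g in GL_2
   changes the support of Ev f by a permutation of the projective line, so the
   supports of minimum-weight codewords are permuted by GL_2(F_q), which is
   3-transitive; hence every 3-set lies in the same number of supports. *)

Require Import Defs.
From mathcomp Require Import all_boot all_order all_algebra.
From mathcomp.multinomials Require Import mpoly.
From mathcomp Require Import ring zify.

Set Implicit Arguments.
Unset Strict Implicit.
Unset Printing Implicit Defensive.

Import GRing.Theory.

(** * Minimum distance of a code *)

Section MinimumDistance.
Local Open Scope ring_scope.
Variables (F : finFieldType) (P : finType).
Implicit Types (c : {ffun P -> F^o}) (C : {vspace {ffun P -> F^o}}).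

Lemma mem_supp c x : (x \in supp c) = (c x != 0).
Proof. by rewrite inE. Qed.

Lemma wt_eq0 c : (wt c == 0%N) = (c == 0).
Proof.
rewrite /wt cards_eq0; apply/eqP/eqP => [s0|->].
  by apply/ffunP=> x; move/setP/(_ x): s0; rewrite !inE ffunE => /negbFE/eqP.
by apply/setP=> x; rewrite !inE ffunE eqxx.
Qed.

Lemma min_distP C : C != 0%VS ->
  exists2 c, [/\ c \in C, c != 0 & wt c = min_dist C] &
    forall c', c' \in C -> c' != 0 -> (min_dist C <= wt c')%N.
Proof.
move=> C0; rewrite /min_dist; case: arg_minnP => [|c /andP[cC c0] cmin].
  by rewrite memv_pick vpick0.
by exists c => // c' c'C c'0; apply: cmin; rewrite c'C.
Qed.

(** With no nonzero codeword, [arg_min] returns its default [vpick], which is 0 here. This lets a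
    positive minimum distance rule out the zero code. *)
Lemma min_dist0 : min_dist (0%VS : {vspace {ffun P -> F^o}}) = 0%N.
Proof.
rewrite /min_dist; set c := arg_min _ _ _.
have -> : c = 0.
  rewrite /c /arg_min /extremum; case: pickP => /= [c' /andP[/andP[]]|_].
    by rewrite memv0 => ->.
  by apply/eqP; rewrite vpick0.
by apply/eqP; rewrite wt_eq0.
Qed.

End MinimumDistance.

(** * Counting blocks along a permutation of the points *)

Section Transport.
Variable P : finType.

(* The preimage under [s] is an injective self-map of the finite set [B], hence
   a permutation of [B]; it sends the sets containing [s @: T] to those
   containing [T]. *)
Lemma card_blocks_over_imset (s : P -> P) (B : {set {set P}}) (T : {set P}) :
  injective s -> (forall S, S \in B -> s @^-1: S \in B) ->
  #|[set S in B | T \subset S]| = #|[set S in B | s @: T \subset S]|.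
Proof.
move=> s_inj sB.
have preI : injective (fun S : {set P} => s @^-1: S).
  move=> S S' /setP eqS; apply/setP=> y.
  by move: (eqS (invF s_inj y)); rewrite !inE f_invF.
have imB : [set s @^-1: S | S : {set P} in B] = B.
  apply/eqP; rewrite eqEcard card_imset // leqnn andbT.
  by apply/subsetP=> _ /imsetP[S SB ->]; apply: sB.
rewrite -[RHS](card_imset _ preI); congr #|pred_of_set _|; apply/setP=> S.
rewrite inE; apply/andP/imsetP => [[]|[S']].
  rewrite -{1}imB => /imsetP[S' S'B ->] TS'; exists S' => //.
  by rewrite inE S'B sub_imset_pre.
by rewrite inE => /andP[S'B TS'] ->; rewrite sB // -sub_imset_pre.
Qed.

End Transport.

(** * Zeros of binary forms on the projective line *)

Section Forms.
Local Open Scope ring_scope.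
Variables (F : finFieldType) (k : nat).
Implicit Types (f : dhomog 2 F k) (x y : P1 F).

Lemma meval_form f (v : 'I_2 -> F) :
  (f : {mpoly F[2]}).@[v] =
  \sum_(m <- msupp f) f@_m * (v 0 ^+ m 0%R * v 1 ^+ (k - m 0%R)).
Proof.
rewrite mevalE; apply: eq_big_seq => m /(dhomog_mf (dhomog_is_dhomog f)) /=.
rewrite mdegE !big_ord_recl !big_ord0 mulr1 addn0 => mk.
have -> : (k - m 0%R)%N = m (lift ord0 ord0) by rewrite -mk addKn.
by have -> : lift ord0 ord0 = 1 :> 'I_2 by apply: val_inj.
Qed.

Lemma form_deg_le f m : m \in msupp f -> (m 0%R <= k)%N.
Proof.
move=> /(dhomog_mf (dhomog_is_dhomog f)) /= <-.
by rewrite mdegE big_ord_recl leq_addr.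
Qed.

Lemma meval_formZ f a (v w : 'I_2 -> F) :
  (forall i, v i = a * w i) ->
  (f : {mpoly F[2]}).@[v] = a ^+ k * (f : {mpoly F[2]}).@[w].
Proof.
move=> vw; rewrite !meval_form big_distrr /=; apply: eq_big_seq => m mf.
rewrite !vw !exprMn -[X in _ = a ^+ X * _](subnKC (form_deg_le mf)) exprD; ring.
Qed.

(* The polynomial f(T, 1). *)
Definition dehom f : {poly F} := \sum_(m <- msupp f) f@_m *: 'X^(m 0%R).

Lemma coef_dehom f i :
  (dehom f)`_i = \sum_(m <- msupp f) f@_m * (m 0%R == i)%:R.
Proof.
rewrite /dehom coef_sum; apply: eq_bigr => m _.
by rewrite coefZ coefXn eq_sym.
Qed.

Lemma size_dehom f : (size (dehom f) <= k.+1)%N.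
Proof.
apply/leq_sizeP => j kj; rewrite coef_dehom big_seq big1 // => m /form_deg_le mk.
by rewrite (_ : _ == _ = false) ?mulr0 //; apply/eqP; lia.
Qed.

Lemma horner_dehom f a : (dehom f).[a] = Ev f (Some a).
Proof.
rewrite ffunE meval_form /dehom horner_sum; apply: eq_bigr => m _.
by rewrite hornerZ hornerXn /= expr1n mulr1.
Qed.

Lemma coef_dehom_deg f : (dehom f)`_k = Ev f None.
Proof.
rewrite ffunE meval_form coef_dehom; apply: eq_big_seq => m /form_deg_le mk.
(* As [m 0 <= k], the truncated difference [k - m 0] is 0 only for [m 0 = k]. *)
rewrite /= expr1n mul1r expr0n; congr (_ * _%:R).
by congr (nat_of_bool _); apply/eqP/eqP; lia.
Qed.

(** In a form of fixed degree the exponent of X determines the monomial, so setting Y = 1 merges no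
    two terms. *)
Lemma dehom_eq0 f : dehom f = 0 -> f = 0.
Proof.
move=> df0; apply: val_inj; apply/mpolyP => m; rewrite mcoeff0.
have [mf|] := boolP (m \in msupp f); last by rewrite mcoeff_msupp negbK => /eqP.
have := coef_dehom f (m 0%R); rewrite df0 coef0 => /esym.
rewrite (bigD1_seq m) ?msupp_uniq //= eqxx mulr1 big_seq_cond big1 ?addr0 //.
move=> m' /andP[m'f m'm]; case: eqP => [e|]; last by rewrite mulr0.
case/eqP: m'm; apply/mnmP => i.
have /eqP := dhomog_mf (dhomog_is_dhomog f) mf.
rewrite /= -(dhomog_mf (dhomog_is_dhomog f) m'f) /= !mdegE !big_ord_recl !big_ord0.
rewrite e !addn0 eqn_add2l => /eqP e1.
case: i => [[|[|//]] lti].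
  by have -> : Ordinal lti = 0 by apply: val_inj.
by have -> : Ordinal lti = lift ord0 ord0 by apply: val_inj.
Qed.

(** The affine zeros are roots of f(T, 1), of degree at most k. A zero at infinity kills the
    coefficient of T^k, so it lowers this bound by one. *)
Lemma form_eq0 f (Z : {set P1 F}) :
  (k < #|Z|)%N -> (forall x, x \in Z -> Ev f x = 0) -> f = 0.
Proof.
move=> kZ fZ; apply: dehom_eq0; apply/eqP/negPn/negP => df0.
pose A := [set a | Some a \in Z].
have cZ : (#|Z| = (None \in Z) + #|A|)%N.
  rewrite (cardsD1 None); congr (_ + _)%N.
  rewrite -(card_imset A (@Some_inj _)); apply: eq_card => -[a|].
    by rewrite inE mem_imset ?inE //; apply: Some_inj.
  by rewrite !inE eqxx /=; apply/esym/imsetP => -[].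
have : (size (enum A) < size (dehom f))%N.
  apply: max_poly_roots; rewrite ?enum_uniq //; apply/allP => a.
  by rewrite mem_enum inE => aZ; rewrite rootE horner_dehom fZ.
rewrite -cardE; move: kZ (size_dehom f); rewrite cZ.
case: (boolP (None \in Z)) => [NZ|_] /= kZ.
  rewrite leq_eqVlt => /orP[/eqP sk|]; last by lia.
  move: df0; rewrite -lead_coef_eq0 /lead_coef sk /= coef_dehom_deg fZ //.
  by rewrite eqxx.
by lia.
Qed.

End Forms.

Lemma det_mx2 (R : comNzRingType) (A : 'M[R]_2) :
  (\det A = A 0 0 * A 1 1 - A 0 1 * A 1 0)%R.
Proof.
rewrite (expand_det_row _ 0%R) !big_ord_recl big_ord0 /cofactor !det_mx11 !mxE /=.
rewrite (_ : lift 0 0 = 1)%R; last exact: val_inj.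
rewrite (_ : lift 1 0 = 0)%R; last exact: val_inj.
by rewrite addr0 expr0 expr1 mul1r mulN1r mulrN.
Qed.

(** * The action of GL_2 on the projective line *)

Section ProjectiveLine.
Local Open Scope ring_scope.
Variable F : finFieldType.
Implicit Types (x y : P1 F) (u v : 'I_2 -> F) (g : 'M[F]_2).

(** The determinant with columns [u] and [v]: for nonzero vectors it vanishes exactly when they
    represent the same point. *)
Definition cross u v : F := u 0 * v 1 - u 1 * v 0.

Local Notation coord x := (tnth (P1_coord x)).

Lemma card_P1 : #|P1 F| = #|F|.+1.
Proof. exact: card_option. Qed.

Lemma cross_coord_eq0 x y : (cross (coord x) (coord y) == 0) = (x == y).
Proof.
rewrite /cross; case: x y => [a|] [b|]; rewrite /= !(tnth_nth 0) /=.
- by rewrite mulr1 mul1r subr_eq0; apply/eqP/eqP => [->|[->]].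
- by rewrite mulr0 mulr1 sub0r oppr_eq0 oner_eq0.
- by rewrite mulr1 mul0r subr0 oner_eq0.
- by rewrite mulr0 mul0r subrr !eqxx.
Qed.

Definition to_P1 u : P1 F := if u 1 == 0 then None else Some (u 0 / u 1).

Lemma to_P1P u : (u 0 != 0) || (u 1 != 0) ->
  exists2 a, a != 0 & forall i, u i = a * coord (to_P1 u) i.
Proof.
rewrite /to_P1; case: (u 1 =P 0) => [u10|/eqP u1 _]; last first.
  exists (u 1) => // -[[|[|//]] lti]; rewrite (tnth_nth 0) /=.
    by rewrite mulrC divfK //; congr u; apply: val_inj.
  by rewrite mulr1; congr u; apply: val_inj.
rewrite orbF => u0; exists (u 0) => // -[[|[|//]] lti]; rewrite (tnth_nth 0) /=.
  by rewrite mulr1; congr u; apply: val_inj.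
by rewrite mulr0 -u10; congr u; apply: val_inj.
Qed.

(** This is the adjugate of [g] applied to [u]. For invertible [g] it is a nonzero multiple of the
    inverse, so [P1_act g] is the usual action of the inverse of [g]. *)
Definition lin_val g u : 'I_2 -> F := fun i => (tnth (lin_subst g) i).@[u].

Lemma lin_val0 g u : lin_val g u 0 = g 1 1 * u 0 - g 0 1 * u 1.
Proof. by rewrite /lin_val (tnth_nth 0) /= mevalB !mevalZ !mevalXU. Qed.

Lemma lin_val1 g u : lin_val g u 1 = - g 1 0 * u 0 + g 0 0 * u 1.
Proof. by rewrite /lin_val (tnth_nth 0) /= mevalD !mevalZ !mevalXU. Qed.

Lemma cross_lin_val g u v : cross (lin_val g u) (lin_val g v) = \det g * cross u v.
Proof. rewrite det_mx2 /cross !lin_val0 !lin_val1; ring. Qed.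

Definition P1_act g x : P1 F := to_P1 (lin_val g (coord x)).

Lemma P1_actP g x : g \in unitmx ->
  exists2 a, a != 0 & forall i, lin_val g (coord x) i = a * coord (P1_act g x) i.
Proof.
rewrite unitmxE unitfE => g0; apply: to_P1P; rewrite -negb_and.
apply/negP => /andP[/eqP v0 /eqP v1].
(* Any point other than [x] serves: if [x] were sent to the zero vector, the cross product of the
   two images would vanish, although [\det g] and the original cross product do not. *)
pose y : P1 F := if x is Some _ then None else Some 0.
have := cross_lin_val g (coord x) (coord y).
rewrite {1}/cross v0 v1 !mul0r subrr => /esym/eqP.
by rewrite mulf_eq0 (negPf g0) cross_coord_eq0 /y; case: (x).
Qed.

Lemma P1_act_inj g : g \in unitmx -> injective (P1_act g).
Proof.
move=> gu x y e; have [a _ gx] := P1_actP x gu; have [b _ gy] := P1_actP y gu.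
have := cross_lin_val g (coord x) (coord y).
rewrite {1}/cross !gx !gy e (_ : _ - _ = 0); last by ring.
move/esym/eqP; move: gu; rewrite unitmxE unitfE => g0.
by rewrite mulf_eq0 (negPf g0) cross_coord_eq0 => /eqP.
Qed.

(** The value of [act g f] at [x] is that of [f] at a nonzero multiple of the coordinates of
    [P1_act g x]; by homogeneity this only contributes a nonzero factor a^k. *)
Lemma supp_Ev_act k g (f : dhomog 2 F k) : g \in unitmx ->
  supp (Ev (act g f)) = P1_act g @^-1: supp (Ev f).
Proof.
move=> gu; apply/setP=> x; rewrite !inE !ffunE /= comp_mpoly_meval.
have [a a0 ga] := P1_actP x gu.
by rewrite (meval_formZ f ga) mulf_eq0 expf_eq0 (negPf a0) andbF.
Qed.

(* The required map is [w -> (cross z x * cross w y : cross z y * cross w x)],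
   sending [x], [y], [z] to [infinity], [0], [1]. *)
Lemma P1_act_3trans (T : {set P1 F}) : #|T| = 3 ->
  exists2 g, g \in unitmx & P1_act g @: T = [set None; Some 0; Some 1].
Proof.
move=> T3; have [x [y [z [-> xy xz yz]]]] :
    exists x y z, [/\ T = [set x; y; z], x != y, x != z & y != z].
  move: (T3); rewrite cardE => sT; have := enum_uniq T.
  have eT : T =i enum T by move=> w; rewrite mem_enum.
  case: (enum T) sT eT => [|x [|y [|z []]]] //= _ eT.
  rewrite !inE !andbT negb_or => /andP[/andP[xy xz] yz].
  by exists x, y, z; split=> //; apply/setP=> w; rewrite eT !inE -orbA.
pose c x y := cross (coord x) (coord y).
have cN s t : c s t != 0 = (s != t) by rewrite /c cross_coord_eq0.
pose a := c z x; pose b := c z y.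
(* Since [lin_val] applies the adjugate, [g] is the adjugate of the matrix of the required map. *)
pose g : 'M[F]_2 := \matrix_(i, j)
  if i == 0 then (if j == 0 then - b * coord x 0 else a * coord y 0)
  else (if j == 0 then - b * coord x 1 else a * coord y 1).
have l0 w : lin_val g (coord w) 0 = a * c w y.
  rewrite lin_val0 !mxE /= /c /cross; ring.
have l1 w : lin_val g (coord w) 1 = b * c w x.
  rewrite lin_val1 !mxE /= /c /cross; ring.
have cc t : c t t = 0 by apply/eqP; rewrite /c cross_coord_eq0.
have a0 : a != 0 by rewrite cN eq_sym.
have b0 : b != 0 by rewrite cN eq_sym.
exists g.
  rewrite unitmxE unitfE det_mx2 !mxE /=.
  rewrite (_ : _ - _ = - (a * b * c x y)); last by rewrite /c /cross; ring.
  by rewrite oppr_eq0 !mulf_neq0 // cN.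
rewrite !imsetU !imset_set1; congr ([set _] :|: [set _] :|: [set _]).
- by rewrite /P1_act /to_P1 l1 cc mulr0 eqxx.
- rewrite /P1_act /to_P1 l0 l1 cc mulr0 mul0r ifN //.
  by rewrite mulf_neq0 // cN eq_sym.
- have ba0 : b * a != 0 by rewrite mulf_neq0.
  by rewrite /P1_act /to_P1 l0 l1 -/a -/b (mulrC a) divff // ifN.
Qed.

End ProjectiveLine.

(** * Blocks and supports of minimum-weight codewords *)

Section Blocks.
Local Open Scope ring_scope.
Variables (F : finFieldType) (k : nat).
Implicit Types (f : dhomog 2 F k) (S : {set P1 F}) (W : {vspace dhomog 2 F k}).

Lemma supp_Ev_F S : #|S| = k -> supp (Ev (indhomog k (F_ S))) = ~: S.
Proof.
move=> Sk; apply/setP => x; rewrite !inE ffunE /indhomog insubdK; last first.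
  by rewrite -Sk; apply: F_homog.
rewrite /F_ rmorph_prod /=; congr (~~ _).
(* Up to sign, the factor for [t] evaluated at [x] is the cross product of their coordinates. *)
have lf t : ((lin_factor t).@[tnth (P1_coord x)] == 0) = (x == t).
  rewrite -cross_coord_eq0 /cross; case: t => [t|] /=.
    by rewrite mevalB mevalZ !mevalXU /= !(tnth_nth 0) /= mulr1 mulrC.
  by rewrite mevalXU /= !(tnth_nth 0) /= mulr0 sub0r mulr1 oppr_eq0.
apply/prodf_eq0/idP => [[t tS]|xS]; first by rewrite lf => /eqP ->.
by exists x; rewrite ?lf.
Qed.

Lemma wt_Ev_F S : #|S| = k -> wt (Ev (indhomog k (F_ S))) = (#|F|.+1 - k)%N.
Proof. by move=> Sk; rewrite /wt supp_Ev_F // cardsCs setCK Sk card_P1. Qed.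

Lemma wt_Ev_ge f : f != 0 -> (#|F|.+1 - k <= wt (Ev f))%N.
Proof.
rewrite leqNgt; apply: contraNN => wf.
have kS : (k < #|~: supp (Ev f)|)%N.
  by rewrite cardsCs setCK card_P1 -/(wt _); lia.
by apply/eqP/(form_eq0 kS) => x; rewrite !inE negbK => /eqP.
Qed.

Lemma mem_code W c : reflect (exists2 f, f \in W & c = Ev f) (c \in code W).
Proof.
apply: (iffP memv_imgP) => -[f fW ->]; exists f => //; by rewrite lfunE.
Qed.

(* With h = F_S, the combination f(x) h - h(x) f vanishes on S and at x outside
   S, so it has k + 1 zeros. *)
Lemma F_proportional f x : Ev f x != 0 -> #|~: supp (Ev f)| = k ->
  let h := indhomog k (F_ (~: supp (Ev f))) in h = (Ev f x)^-1 *: (Ev h x *: f).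
Proof.
set S := ~: _ => fx Sk h; apply: (scalerI fx); rewrite scalerA divff // scale1r.
apply/eqP; rewrite -subr_eq0; apply/eqP/(@form_eq0 _ _ _ (x |: S)).
  by rewrite cardsU1 Sk !inE negbK fx.
move=> y; have -> : Ev (Ev f x *: h - Ev h x *: f) y =
    Ev f x * Ev h y - Ev h x * Ev f y.
  by rewrite linearB !linearZ !ffunE.
case/setU1P => [->|yS]; first by rewrite mulrC subrr.
have /eqP -> : Ev h y == 0.
  by rewrite -[_ == 0]negbK -[~~ (_ == 0)]mem_supp supp_Ev_F // inE negbK.
by move: yS; rewrite inE mem_supp negbK => /eqP ->; rewrite !mulr0 subrr.
Qed.

Lemma blocks_min_dist W : (k <= #|F|)%N ->
  blocks W != set0 <-> min_dist (code W) = (#|F|.+1 - k)%N.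
Proof.
move=> kq; split=> [/set0Pn[S]|dW].
  rewrite inE => /andP[/eqP Sk SW]; have wS := wt_Ev_F Sk.
  have hW : Ev (indhomog k (F_ S)) \in code W.
    by apply/mem_code; exists (indhomog k (F_ S)).
  (* Here [k <= #|F|] makes the weight positive. *)
  have h0 : Ev (indhomog k (F_ S)) != 0 by rewrite -wt_eq0 wS; lia.
  have C0 : code W != 0%VS.
    by apply: contraNneq h0 => C0; rewrite -memv0 -C0.
  have [_ [/mem_code[f fW ->] f0 wf] dmin] := min_distP C0.
  apply/eqP; rewrite eqn_leq -{1}wS dmin //= -wf wt_Ev_ge //.
  by apply: contraNneq f0 => ->; rewrite linear0.
have C0 : code W != 0%VS.
  by apply/eqP=> C0; move: dW; rewrite C0 min_dist0; lia.
have [_ [/mem_code[f fW ->] f0 wf] _] := min_distP C0.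
(* The zero set of a minimum-weight word is the block sought: its form is a multiple of [f]. *)
have Sk : #|~: supp (Ev f)| = k.
  by rewrite cardsCs setCK -/(wt _) wf dW card_P1; lia.
have [x fx] : exists x, x \in supp (Ev f).
  by apply/set0Pn; rewrite -cards_eq0 -/(wt _) wf dW; lia.
apply/set0Pn; exists (~: supp (Ev f)); rewrite inE Sk eqxx /=.
by rewrite (@F_proportional f x) -?mem_supp // !memvZ.
Qed.

(** The preimage of the support of [Ev f] is the support of [Ev (act g f)], and bijectivity of
    [P1_act g] preserves the weight. *)
Lemma min_supports_preim W g S : GL2_invariant W -> g \in unitmx ->
  S \in min_supports (code W) -> P1_act g @^-1: S \in min_supports (code W).
Proof.
move=> Winv gu /imsetP[c]; rewrite inE => /andP[/mem_code[f fW ->] /eqP wf] ->.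
rewrite -supp_Ev_act //; apply: imset_f; rewrite inE -wf; apply/andP; split.
  by apply/mem_code; exists (act g f); rewrite ?Winv.
rewrite /wt supp_Ev_act // card_preimset //; exact: P1_act_inj.
Qed.

End Blocks.

Theorem lemma5 (F : finFieldType) (q k : nat) (W : {vspace dhomog 2 F k}) :
  #|F| = q -> k <= q -> GL2_invariant W ->
  (blocks W != set0 <-> min_dist (code W) = q.+1 - k) /\
  (blocks W != set0 ->
     exists lambda : nat,
       is_design 3 q.+1 (q.+1 - k) lambda (min_supports (code W))).
Proof.
move=> <- kq Winv; split; first exact: blocks_min_dist.
move=> /(blocks_min_dist W kq) dW.
set B := min_supports _.
(* The count over the reference triple infinity, 0, 1, to which every 3-set is carried by some
   [g]. *)
exists #|[set S in B | [set None; Some 0%R; Some 1%R] \subset S]|; split.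
- exact: card_P1.
- by move=> S /imsetP[c]; rewrite inE => /andP[_ /eqP wc] ->; rewrite -dW -wc.
- move=> T /P1_act_3trans[g gu <-]; apply: card_blocks_over_imset.
    exact: P1_act_inj.
  by move=> S; apply: min_supports_preim.
Qed.
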